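(* Neither $M_3\otimes F(3)$ nor $F(3)\otimes F(3)$ is a lattice, where $M_3$ is the five-element diamond lattice (a least element, a greatest element and three pairwise incomparable atoms) and $F(3)$ is the free lattice on three generators.
   Context: Tensor product. For lattices $A$, $B$ with least elements $0$, put $\bot_{A,B}=(A\times\{0\})\cup(\{0\}\times B)$. A bi-ideal of $A\times B$ is a subset $I\subseteq A\times B$ which is a down-set (for the componentwise order), contains $\bot_{A,B}$, and is closed under lateral joins: $(a,b_0),(a,b_1)\in I$ implies $(a,b_0\vee b_1)\in I$, and $(a_0,b),(a_1,b)\in I$ implies $(a_0\vee a_1,b)\in I$. Ordered by inclusion, the bi-ideals form an algebraic lattice $A\,\bar\otimes\, B$. For $a\in A$, $b\in B$ the pure tensor is the bi-ideal $a\otimes b=\bot_{A,B}\cup\{(x,y)\in A\times B : x\le a,\ y\le b\}$. The tensor product $A\otimes B$ is the join-semilattice with zero of compact elements of $A\,\bar\otimes\,B$, i.e. the set of all finite joins (in $A\,\bar\otimes\,B$) of pure tensors, ordered by inclusion. ''$A\otimes B$ is a lattice'' means that this ordered set is a lattice. The lattice $F(3)$ has a least element, namely the meet of its three generators. *)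

(* Defs.v *)
From HB Require Import structures.
From mathcomp Require Import all_boot all_order.
From mathcomp Require Import boolp classical_sets.

Set Implicit Arguments.
Unset Strict Implicit.
Unset Printing Implicit Defensive.

Import Order.TTheory.

Local Open Scope classical_set_scope.
Local Open Scope order_scope.

Section TensorProduct.
Context {dA dB : Order.disp_t} (A : bLatticeType dA) (B : bLatticeType dB).

Definition tensor_bot : set (A * B) := [set p | p.1 = \bot \/ p.2 = \bot].

Definition bi_ideal (I : set (A * B)) : Prop :=
  [/\ forall a b a' b', a' <= a -> b' <= b -> I (a, b) -> I (a', b'),
      tensor_bot `<=` I,
      forall a b0 b1, I (a, b0) -> I (a, b1) -> I (a, b0 `|` b1) &
      forall a0 a1 b, I (a0, b) -> I (a1, b) -> I (a0 `|` a1, b)].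

Definition pure_tensor (a : A) (b : B) : set (A * B) :=
  [set p | tensor_bot p \/ (p.1 <= a /\ p.2 <= b)].

(* The join, in the lattice of all bi-ideals, of a family of bi-ideals. *)
Definition bi_join (S : set (set (A * B))) : set (A * B) :=
  smallest bi_ideal (\bigcup_(J in S) J).

Definition bi_compact (I : set (A * B)) : Prop :=
  forall S : set (set (A * B)), S `<=` bi_ideal -> I `<=` bi_join S ->
  exists2 s : seq (set (A * B)), [set` s] `<=` S & I `<=` bi_join [set` s].

(* The compact elements of the lattice of bi-ideals; by [tensorE] below, these
   are the finite joins of pure tensors. *)
Definition tensor : set (set (A * B)) :=
  [set I | bi_ideal I /\ bi_compact I].

Lemma bi_ideal_smallest (G : set (A * B)) : bi_ideal (smallest bi_ideal G).
Proof.
split=> [a b a' b' aa' bb' Iab J [bJ GJ] | p p0 J [[_ + _ _] _] |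
         a b0 b1 I0 I1 J [bJ GJ] | a0 a1 b I0 I1 J [bJ GJ]].
- by case: (bJ) => + _ _ _; apply; [exact: aa'|exact: bb'|exact: Iab].
- exact.
- by case: (bJ) => _ _ + _; apply; [exact: I0|exact: I1].
- by case: (bJ) => _ _ _; apply; [exact: I0|exact: I1].
Qed.

Lemma bi_ideal_pure_tensor a b : bi_ideal (pure_tensor a b).
Proof.
split=> [x y x' y' xx' yy' | p | x y0 y1 | x0 x1 y].
- case=> [[]/= e0|[/= xa yb]].
  + by left; left; apply/eqP; rewrite /= -lex0 -e0.
  + by left; right; apply/eqP; rewrite /= -lex0 -e0.
  + by right; split=> /=; [exact: le_trans xa|exact: le_trans yb].
- by left.
- case=> [[]/= e0|[/= xa yb]] [[]/= e1|[/= xa' yb']].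
  + by left; left.
  + by left; left.
  + by left; left.
  + by left; left.
  + by left; right; rewrite /= e0 e1 joinxx.
  + by right; split=> //=; rewrite e0 join0x.
  + by left; left.
  + by right; split=> //=; rewrite e1 joinx0.
  + by right; split=> //=; rewrite leUx yb.
- case=> [[]/= e0|[/= xa yb]] [[]/= e1|[/= xa' yb']].
  + by left; left; rewrite /= e0 e1 joinxx.
  + by left; right.
  + by right; split=> //=; rewrite e0 join0x.
  + by left; right.
  + by left; right.
  + by left; right.
  + by right; split=> //=; rewrite e1 joinx0.
  + by left; right.
  + by right; split=> //=; rewrite leUx xa.
Qed.

Lemma pure_tensorS a b (I : set (A * B)) :
  bi_ideal I -> I (a, b) -> pure_tensor a b `<=` I.
Proof.
move=> [Id I0 _ _] Iab [x y] [|[/= xa yb]]; first exact: I0.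
exact: Id Iab.
Qed.

Lemma bi_joinS S S' : S `<=` S' -> bi_join S `<=` bi_join S'.
Proof.
move=> SS'; apply: sub_smallest2r; first exact: bi_ideal_smallest.
exact: bigcup_subset.
Qed.

Lemma bi_join_finitary (S : set (set (A * B))) p : bi_join S p ->
  exists2 s : seq (set (A * B)), [set` s] `<=` S & bi_join [set` s] p.
Proof.
pose U : set (A * B) := [set q |
  exists2 s : seq (set (A * B)), [set` s] `<=` S & bi_join [set` s] q].
suff /smallest_sub : bi_ideal U.
  move=> + pS; apply; last exact: pS.
  move=> q [J SJ Jq]; exists [:: J].
    by move=> K /=; rewrite inE => /eqP ->.
  by move=> K [_]; apply; exists J => //=; rewrite inE.
have catS (s t : seq (set (A * B))) : [set` s] `<=` S -> [set` t] `<=` S ->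
    [/\ [set` s ++ t] `<=` S, [set` s] `<=` [set` s ++ t] &
        [set` t] `<=` [set` s ++ t]].
  move=> sS tS; split=> J /=; rewrite mem_cat; first by case/orP=> [/sS|/tS].
  - by move=> ->.
  - by move=> ->; rewrite orbT.
split=> [a b a' b' aa' bb' [s sS Is] | q q0 | a b0 b1 | a0 a1 b].
- exists s => //; have [+ _ _ _] := bi_ideal_smallest (\bigcup_(J in [set` s]) J).
  by apply; [exact: aa'|exact: bb'|exact: Is].
- exists [::]; first by [].
  by have [_ + _ _] := bi_ideal_smallest (\bigcup_(J in [set` [::]]) J); apply.
- move=> [s sS Is] [t tS It]; have [? st ts] := catS _ _ sS tS.
  exists (s ++ t) => //.
  have [_ _ + _] := bi_ideal_smallest (\bigcup_(J in [set` s ++ t]) J).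
  by apply; [exact: (bi_joinS st)|exact: (bi_joinS ts)].
- move=> [s sS Is] [t tS It]; have [? st ts] := catS _ _ sS tS.
  exists (s ++ t) => //.
  have [_ _ _] := bi_ideal_smallest (\bigcup_(J in [set` s ++ t]) J).
  by apply; [exact: (bi_joinS st)|exact: (bi_joinS ts)].
Qed.

Lemma tensorE (I : set (A * B)) : tensor I <->
  exists s : seq (A * B),
    I = bi_join [set` [seq pure_tensor p.1 p.2 | p <- s]].
Proof.
split=> [[bI cI]|[s ->]].
  pose P := [set J | exists2 p, I p & J = pure_tensor p.1 p.2].
  have [|p Ip J [_]|t tP It] := cI P.
  - by move=> _ [p _ ->]; exact: bi_ideal_pure_tensor.
  - by apply; exists (pure_tensor p.1 p.2); [exists p|right].
  have [s sI et] : exists2 s : seq (A * B),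
      [set` s] `<=` I & t = [seq pure_tensor p.1 p.2 | p <- s].
    elim: t tP {It} => [|J t IH] tP; first by exists [::].
    have [p Ip ->] : P J by apply: tP; rewrite /= inE eqxx.
    have [|s sI ->] := IH.
      by move=> K Kt; apply: tP; move: Kt; rewrite /= inE => ->; rewrite orbT.
    by exists (p :: s) => // q; rewrite /= inE => /orP[/eqP ->|/sI].
  exists s; rewrite -et; apply/seteqP; split=> //.
  apply: smallest_sub => // q [J Jt Jq].
  have [p Ip eJ] := tP _ Jt; rewrite eJ in Jq.
  by apply: (pure_tensorS bI _ Jq); case: (p) Ip.
split; first exact: bi_ideal_smallest.
move=> S bS sS.
suff [t tS tP] : exists2 t : seq (set (A * B)), [set` t] `<=` S &
    forall p, p \in s -> bi_join [set` t] p.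
  exists t => //; apply: smallest_sub; first exact: bi_ideal_smallest.
  move=> q [J /mapP[[a b] /tP ps ->]].
  by apply: pure_tensorS => //; exact: bi_ideal_smallest.
have {}sS p : p \in s -> bi_join S p.
  move=> ps; apply: sS => J [_]; apply.
  by exists (pure_tensor p.1 p.2); [exact: map_f|right].
elim: s sS => [|p s IH] sS; first by exists [::].
have [|t tS tP] := IH; first by move=> q qs; apply: sS; rewrite inE qs orbT.
have [|u uS uP] := @bi_join_finitary S p; first by apply: sS; rewrite inE eqxx.
exists (u ++ t) => [J /=|q]; first by rewrite mem_cat => /orP[/uS|/tS].
rewrite inE => /orP[/eqP ->|/tP].
  by apply: bi_joinS uP => J /=; rewrite mem_cat => ->.
by apply: bi_joinS => J /=; rewrite mem_cat => ->; rewrite orbT.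
Qed.

End TensorProduct.

Arguments tensor {dA dB} A B _.

(* The members of [C], ordered by inclusion, form a lattice: any two have a
   greatest lower bound and a least upper bound among the members of [C] (not
   necessarily their intersection and union). *)
Definition is_lattice {T : Type} (C : set (set T)) : Prop :=
  forall I J, C I -> C J ->
  (exists2 K, C K &
     [/\ K `<=` I, K `<=` J &
         forall L, C L -> L `<=` I -> L `<=` J -> L `<=` K]) /\
  (exists2 K, C K &
     [/\ I `<=` K, J `<=` K &
         forall L, C L -> I `<=` L -> J `<=` L -> K `<=` L]).

Inductive M3 := M3_bot | M3_atom of 'I_3 | M3_top.

Definition M3_encode (x : M3) : option (option 'I_3) :=
  match x with
  | M3_bot => None | M3_atom i => Some (Some i) | M3_top => Some None
  end.

Definition M3_decode (x : option (option 'I_3)) : M3 :=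
  match x with
  | None => M3_bot | Some (Some i) => M3_atom i | Some None => M3_top
  end.

Lemma M3_encodeK : cancel M3_encode M3_decode. Proof. by case. Qed.

HB.instance Definition _ := Finite.copy M3 (can_type M3_encodeK).

Definition M3_le (x y : M3) : bool :=
  match x, y with
  | M3_bot, _ | _, M3_top => true
  | M3_atom i, M3_atom j => i == j
  | _, _ => false
  end.

Definition M3_meet (x y : M3) : M3 :=
  match x, y with
  | M3_top, z | z, M3_top => z
  | M3_atom i, M3_atom j => if i == j then M3_atom i else M3_bot
  | _, _ => M3_bot
  end.

Definition M3_join (x y : M3) : M3 :=
  match x, y with
  | M3_bot, z | z, M3_bot => z
  | M3_atom i, M3_atom j => if i == j then M3_atom i else M3_top
  | _, _ => M3_top
  end.

Fact M3_display : Order.disp_t. Proof. exact: Order.Disp tt tt. Qed.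

Lemma M3_le_refl : reflexive M3_le. Proof. by case=> //= i. Qed.

Lemma M3_le_anti : antisymmetric M3_le.
Proof. by case=> [|i|] [|j|] //=; case/andP=> /eqP ->. Qed.

Lemma M3_le_trans : transitive M3_le.
Proof. by case=> [|i|] [|j|] [|k|] //= /eqP ->. Qed.

HB.instance Definition _ :=
  Order.Le_isPOrder.Build M3_display M3 M3_le_refl M3_le_anti M3_le_trans.

Lemma M3_meetP (x y z : M3) : (x <= M3_meet y z) = (x <= y) && (x <= z).
Proof.
rewrite /Order.le /=; case: x y z => [|i|] [|j|] [|k|];
  rewrite /= ?andbF ?andbT //; case: (eqVneq j k) => [?|jk];
  subst=> //=; rewrite ?andbb //.
by case: (eqVneq i j) => [->|//]; rewrite (negbTE jk).
Qed.

Lemma M3_joinP (x y z : M3) : (M3_join x y <= z) = (x <= z) && (y <= z).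
Proof.
rewrite /Order.le /=; case: x y z => [|i|] [|j|] [|k|];
  rewrite /= ?andbF ?andbT //; case: (eqVneq i j) => [?|ij];
  subst=> //=; rewrite ?andbb //.
by case: (eqVneq i k) ij => [->|//]; rewrite eq_sym => /negbTE.
Qed.

HB.instance Definition _ :=
  Order.POrder_MeetJoin_isLattice.Build M3_display M3 M3_meetP M3_joinP.

Lemma M3_le0x (x : M3) : M3_bot <= x. Proof. by []. Qed.

HB.instance Definition _ :=
  Order.hasBottom.Build M3_display M3 M3_le0x.

(* [F] is free on the family [g]: homomorphisms preserve binary meets and joins
   only, so the least element of the target, if any, plays no role. *)
Definition free_lattice {d} (F : latticeType d) {X : Type} (g : X -> F) : Prop :=
  forall (d' : Order.disp_t) (L : latticeType d') (v : X -> L),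
  exists! f : F -> L,
    [/\ Order.meet_morphism f, Order.join_morphism f & forall i, f (g i) = v i].

(* F(3) is built as lattice terms modulo the identities valid in all lattices,
   to show that [free_lattice] is satisfiable on three generators. *)
Inductive term3 := Var of 'I_3 | Meet of term3 & term3 | Join of term3 & term3.

HB.instance Definition _ := gen_eqMixin term3.
HB.instance Definition _ := gen_choiceMixin term3.

Fixpoint term_eval d (L : latticeType d) (v : 'I_3 -> L) (t : term3) : L :=
  match t with
  | Var i => v i
  | Meet t u => term_eval v t `&` term_eval v u
  | Join t u => term_eval v t `|` term_eval v u
  end.

Definition term_le (t u : term3) : bool :=
  `[< forall d (L : latticeType d) (v : 'I_3 -> L),
        term_eval v t <= term_eval v u >].

Definition term_eqv (t u : term3) : bool := term_le t u && term_le u t.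

Lemma term_le_refl : reflexive term_le.
Proof. by move=> t; apply/asboolP. Qed.

Lemma term_le_trans : transitive term_le.
Proof.
move=> u t w /asboolP tu /asboolP uw; apply/asboolP => d L v.
exact: le_trans (tu _ _ _) (uw _ _ _).
Qed.

Lemma term_eqv_refl : reflexive term_eqv.
Proof. by move=> t; rewrite /term_eqv term_le_refl. Qed.

Lemma term_eqv_sym : symmetric term_eqv.
Proof. by move=> t u; rewrite /term_eqv andbC. Qed.

Lemma term_eqv_trans : transitive term_eqv.
Proof.
move=> u t w /andP[tu ut] /andP[uw wu].
by apply/andP; split; [exact: term_le_trans uw|exact: term_le_trans ut].
Qed.

Canonical term_equiv :=
  EquivRel term_eqv term_eqv_refl term_eqv_sym term_eqv_trans.

Definition F3 := {eq_quot term_equiv}%qT.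
HB.instance Definition _ := Choice.on F3.

Definition cls (t : term3) : F3 := \pi_F3%qT t.

Lemma cls_repr (x : F3) : cls (repr x) = x. Proof. exact: reprK. Qed.

Lemma cls_eqv (t : term3) : term_eqv (repr (cls t)) t.
Proof. by apply/eqmodP; rewrite -/(cls _) cls_repr. Qed.

Lemma repr_clsl t u : term_le (repr (cls t)) u = term_le t u.
Proof.
have /andP[rt tr] := cls_eqv t.
by apply/idP/idP; [exact: term_le_trans tr|exact: term_le_trans rt].
Qed.

Lemma repr_clsr t u : term_le u (repr (cls t)) = term_le u t.
Proof.
have /andP[rt tr] := cls_eqv t.
by apply/idP/idP => ut; [exact: term_le_trans ut rt|exact: term_le_trans ut tr].
Qed.

Definition F3_le (x y : F3) : bool := term_le (repr x) (repr y).

Lemma F3_le_refl : reflexive F3_le.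
Proof. by move=> x; exact: term_le_refl. Qed.

Lemma F3_le_anti : antisymmetric F3_le.
Proof.
by move=> x y xy; rewrite -[x]cls_repr -[y]cls_repr; apply/eqmodP.
Qed.

Lemma F3_le_trans : transitive F3_le.
Proof. by move=> y x z; exact: term_le_trans. Qed.

Fact F3_display : Order.disp_t. Proof. exact: Order.Disp tt tt. Qed.

HB.instance Definition _ :=
  Order.Le_isPOrder.Build F3_display F3 F3_le_refl F3_le_anti F3_le_trans.

Definition F3_meet (x y : F3) : F3 := cls (Meet (repr x) (repr y)).
Definition F3_join (x y : F3) : F3 := cls (Join (repr x) (repr y)).

Lemma F3_meetP (x y z : F3) : (x <= F3_meet y z) = (x <= y) && (x <= z).
Proof.
rewrite [LHS]repr_clsr; apply/asboolP/andP => [xyz|[/asboolP xy /asboolP xz]].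
  by split; apply/asboolP => d L v; have := xyz d L v; rewrite lexI => /andP[].
by move=> d L v; rewrite lexI xy xz.
Qed.

Lemma F3_joinP (x y z : F3) : (F3_join x y <= z) = (x <= z) && (y <= z).
Proof.
rewrite [LHS]repr_clsl; apply/asboolP/andP => [xyz|[/asboolP xz /asboolP yz]].
  by split; apply/asboolP => d L v; have := xyz d L v; rewrite leUx => /andP[].
by move=> d L v; rewrite leUx xz yz.
Qed.

HB.instance Definition _ :=
  Order.POrder_MeetJoin_isLattice.Build F3_display F3 F3_meetP F3_joinP.

Definition F3_gen (i : 'I_3) : F3 := cls (Var i).

Lemma le_cls t u : (cls t <= cls u) = term_le t u.
Proof. by rewrite [LHS]repr_clsr repr_clsl. Qed.

Lemma cls_Meet t u : cls (Meet t u) = cls t `&` cls u.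
Proof.
apply/le_anti/andP; split.
  rewrite lexI !le_cls; apply/andP.
  by split; apply/asboolP => d L v /=; [exact: leIl|exact: leIr].
rewrite le_cls; apply/asboolP => d L v /=.
by rewrite leI2 //; [have := cls_eqv t|have := cls_eqv u];
  case/andP=> /asboolP + _; apply.
Qed.

Lemma cls_Join t u : cls (Join t u) = cls t `|` cls u.
Proof.
apply/le_anti/andP; split; last first.
  rewrite leUx !le_cls; apply/andP.
  by split; apply/asboolP => d L v /=; [exact: leUl|exact: leUr].
rewrite le_cls; apply/asboolP => d L v /=.
by rewrite leU2 //; [have := cls_eqv t|have := cls_eqv u];
  case/andP=> _ /asboolP; apply.
Qed.

Definition F3_bot : F3 :=
  F3_gen ord0 `&` F3_gen (inord 1) `&` F3_gen (inord 2).

Lemma F3_le0x (x : F3) : F3_bot <= x.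
Proof.
rewrite -[x]cls_repr; elim: (repr x) => [i|t le_t u le_u|t le_t u le_u].
- have [->|[->|->]] : i = ord0 \/ i = inord 1 \/ i = inord 2.
    case: i => [[|[|[|//]]] i3]; [left|right; left|right; right];
    by apply/val_inj; rewrite /= ?inordK.
  + by rewrite /F3_bot -meetA leIl.
  + by rewrite /F3_bot meetAC leIr.
  + by rewrite /F3_bot leIr.
- by rewrite cls_Meet lexI le_t.
- by rewrite cls_Join (le_trans le_t) ?leUl.
Qed.

HB.instance Definition _ := Order.hasBottom.Build F3_display F3 F3_le0x.

Lemma F3_free : free_lattice F3_gen.
Proof.
move=> d L v.
have leP (t u : term3) : term_le t u -> term_eval v t <= term_eval v u.
  by move=> /asboolP; apply.
have eP (t : term3) : term_eval v (repr (cls t)) = term_eval v t.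
  by have /andP[/leP rt /leP tr] := cls_eqv t; apply/le_anti; rewrite rt tr.
exists (fun x => term_eval v (repr x)); split.
  split=> [x y|x y|i]; by rewrite eP.
move=> f [fI fU fg]; apply/funext => x; rewrite -[in RHS](cls_repr x).
elim: (repr x) => [i|t IHt u IHu|t IHt u IHu] /=; first by rewrite -fg.
- by rewrite cls_Meet fI IHt IHu.
- by rewrite cls_Join fU IHt IHu.
Qed.

Lemma free_lattice3_exists : exists d (F : bLatticeType d) (g : 'I_3 -> F),
  free_lattice g.
Proof. by exists F3_display, F3, F3_gen; exact: F3_free. Qed.

(* Main.v *)
Require Import Defs.
From mathcomp Require Import all_boot all_order.
From HB Require Import structures.
From mathcomp Require Import boolp classical_sets.
From mathcomp Require Import zify.

Set Implicit Arguments.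
Unset Strict Implicit.
Unset Printing Implicit Defensive.

Import Order.TTheory.

Local Open Scope classical_set_scope.
Local Open Scope order_scope.

(* If a tensor product is a lattice, its meets are intersections, so it is
   enough to find two compact bi-ideals whose intersection is not compact.  In
   M3 (x) F the join of the pure tensors (i-th atom) (x) g_i is generated by
   iterating x |-> x \/ (y /\ z) cyclically on (g_0, g_1, g_2); intersecting it
   with (0-th atom) (x) 1 isolates the first component of this sequence, which
   does not stabilize.  To see the latter, map F to the lattice of the sets S of
   natural numbers such that k, k + 2 \in S imply k + 1 \in S, sending g_i
   essentially to the residue class of i modulo 3: the n-th iterates all contain
   n, but remain within an initial segment added to the original class.
   Finally, a surjective homomorphism A -> A' maps compact bi-ideals of A x B onto
   compact bi-ideals of A' x B and commutes with their intersections, so that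
   the second claim follows from the first through F -> M3, g_i |-> i-th atom. *)

(** * Meets in a tensor product *)

Section Tensor.
Context {dA dB : Order.disp_t} (A : bLatticeType dA) (B : bLatticeType dB).

Lemma tensor_pure_tensor (a : A) (b : B) : tensor A B (pure_tensor a b).
Proof.
apply/tensorE; exists [:: (a, b)]; apply/seteqP; split=> p.
  by move=> abp J [_]; apply; exists (pure_tensor a b) => //=; rewrite inE.
apply; split; first exact: bi_ideal_pure_tensor.
by move=> q [J /=]; rewrite inE => /eqP ->.
Qed.

(* The meet of two elements contains every pure tensor below both of them,
   hence it is their intersection. *)
Lemma is_lattice_tensorI (I J : set (A * B)) : is_lattice (tensor A B) ->
  tensor A B I -> tensor A B J -> tensor A B (I `&` J).
Proof.
move=> lat tI tJ; have [[K tK [KI KJ maxK]] _] := lat I J tI tJ.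
have [[bI _] [bJ _]] := (tI, tJ).
suff -> : I `&` J = K by [].
apply/seteqP; split=> [[a b] [Iab Jab]|p Kp]; last by split; [exact: KI|exact: KJ].
apply: (maxK (pure_tensor a b)).
- exact: tensor_pure_tensor.
- exact: pure_tensorS.
- exact: pure_tensorS.
- by right.
Qed.

End Tensor.

(** * Images of bi-ideals under a surjective homomorphism of the first factor *)

Section TensorImage.
Context {d d' dB : Order.disp_t} {A : bLatticeType d} {A' : bLatticeType d'}.
Context (B : bLatticeType dB) (h : A -> A').
Hypotheses (hI : Order.meet_morphism h) (hU : Order.join_morphism h).
Hypothesis h_surj : forall a', exists a, h a = a'.

Let h_homo a b : a <= b -> h a <= h b.
Proof. by rewrite !leEmeet => /eqP ab; rewrite -hI ab. Qed.

Let h0 : h \bot = \bot.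
Proof.
have [a ha] := h_surj \bot.
by apply/eqP; rewrite -lex0 -ha h_homo // le0x.
Qed.

Definition bi_image (I : set (A * B)) : set (A' * B) :=
  [set q | exists2 a, I (a, q.2) & h a = q.1].

(** Two preimages of one point can be replaced by their meet: [h] sends it to the same point, and
    down-closure keeps it in [I]. *)
Lemma bi_ideal_image I : bi_ideal I -> bi_ideal (bi_image I).
Proof.
move=> [Id I0 IU UI].
split=> [a b a' b' aa' bb' /= [x Ixb xa] | [a b] [/= a0|/= b0] |
         a b0 b1 /= [x Ix xa] [y Iy ya] | a0 a1 b /= [x Ix xa] [y Iy ya]].
- have [x' hx'] := h_surj a'; exists (x' `&` x) => /=.
    by apply: Id Ixb => //; exact: leIr.
  by rewrite hI hx' xa; apply/meet_idPl.
- by exists \bot; [apply: I0; left|rewrite /= a0].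
- by have [x hx] := h_surj a; exists x => //=; apply: I0; right.
- exists (x `&` y); last by rewrite /= hI xa ya meetxx.
  by apply: IU; [apply: Id Ix|apply: Id Iy] => //; [exact: leIl|exact: leIr].
- by exists (x `|` y) => /=; [exact: UI|rewrite hU xa ya].
Qed.

Lemma bi_ideal_preimage (J : set (A' * B)) :
  bi_ideal J -> bi_ideal [set p : A * B | J (h p.1, p.2)].
Proof.
move=> [Jd J0 JU UJ].
split=> [a b a' b' aa' bb' /= | [a b] [/= a0|/= b0] | a b0 b1 /= | a0 a1 b /=].
- exact/Jd/bb'/h_homo.
- by apply: J0; left; rewrite /= a0 h0.
- by apply: J0; right.
- exact: JU.
- by rewrite hU; exact: UJ.
Qed.

Lemma bi_image_setI I J : bi_ideal I -> bi_ideal J ->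
  bi_image (I `&` J) = bi_image I `&` bi_image J.
Proof.
move=> [Id _ _ _] [Jd _ _ _]; apply/seteqP; split=> [[a b]|[a b]] /=.
  by move=> [x [Ix Jx] xa]; split; exists x.
move=> [[x Ix xa] [y Jy ya]]; exists (x `&` y); last by rewrite /= hI xa ya meetxx.
by split; [apply: Id Ix|apply: Jd Jy] => //; [exact: leIl|exact: leIr].
Qed.

Lemma bi_image_join (s : seq (A * B)) :
  bi_image (bi_join [set` [seq pure_tensor p.1 p.2 | p <- s]]) =
  bi_join [set` [seq pure_tensor p.1 p.2 | p <- [seq (h p.1, p.2) | p <- s]]].
Proof.
apply/seteqP; split=> [[_ b] [a /= Iab <-] J [bJ sJ]|].
  apply: (Iab [set p | J (h p.1, p.2)]); split; first exact: (bi_ideal_preimage bJ).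
  move=> q [_ /mapP[p ps ->] pq].
  apply: (pure_tensorS (bi_ideal_preimage bJ) _ pq) => /=.
  apply: sJ; exists (pure_tensor (h p.1) p.2); last by right.
  by apply/mapP; exists (h p.1, p.2) => //;
    exact: (map_f (fun p => (h p.1, p.2)) ps).
apply: smallest_sub; first exact/bi_ideal_image/bi_ideal_smallest.
move=> q [_ /mapP[_ /mapP[p ps ->] ->]].
apply: pure_tensorS; first exact/bi_ideal_image/bi_ideal_smallest.
exists p.1 => //= J [_]; apply; exists (pure_tensor p.1 p.2); last by right.
exact: map_f.
Qed.

Lemma tensor_image I : tensor A B I -> tensor A' B (bi_image I).
Proof. by move=> /tensorE[s ->]; rewrite bi_image_join; apply/tensorE; eexists. Qed.

Lemma tensor_image_surj I' : tensor A' B I' ->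
  exists2 I, tensor A B I & bi_image I = I'.
Proof.
move=> /tensorE[s' ->].
have [s <-] : exists s : seq (A * B), [seq (h p.1, p.2) | p <- s] = s'.
  elim: s' => [|[a' b] s' [s <-]]; first by exists [::].
  by have [a <-] := h_surj a'; exists ((a, b) :: s).
exists (bi_join [set` [seq pure_tensor p.1 p.2 | p <- s]]).
  by apply/tensorE; exists s.
exact: bi_image_join.
Qed.

Lemma tensorI_image :
  (forall I J, tensor A B I -> tensor A B J -> tensor A B (I `&` J)) ->
  forall I J, tensor A' B I -> tensor A' B J -> tensor A' B (I `&` J).
Proof.
move=> tI _ _ /tensor_image_surj[I IT <-] /tensor_image_surj[J JT <-].
rewrite -bi_image_setI; [|by case: IT|by case: JT].
exact/tensor_image/tI.
Qed.

End TensorImage.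

(** * The lattice of gap-closed sets *)

Definition gap_closed (S : set nat) : Prop :=
  forall k, S k -> S k.+2 -> S k.+1.

Definition gap_closedb (S : set nat) : bool := `[< gap_closed S >].

Definition gap_set := {S : set nat | gap_closedb S}.

HB.instance Definition _ := SubChoice.on gap_set.

Lemma gap_setP (S : gap_set) : gap_closed (val S).
Proof. by apply/asboolP; exact: (valP S). Qed.

Definition gap_le (S T : gap_set) : bool := `[< val S `<=` val T >].

Lemma gap_le_refl : reflexive gap_le.
Proof. by move=> S; apply/asboolP. Qed.

Lemma gap_le_anti : antisymmetric gap_le.
Proof.
move=> S T /andP[/asboolP ST /asboolP TS]; apply: val_inj.
exact/seteqP.
Qed.

Lemma gap_le_trans : transitive gap_le.
Proof.
move=> T S U /asboolP ST /asboolP TU; apply/asboolP.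
exact: subset_trans TU.
Qed.

Fact gap_display : Order.disp_t. Proof. exact: Order.Disp tt tt. Qed.

HB.instance Definition _ :=
  Order.Le_isPOrder.Build gap_display gap_set gap_le_refl gap_le_anti gap_le_trans.

Lemma gap_leP (S T : gap_set) : reflect (val S `<=` val T) (S <= T).
Proof. exact: asboolP. Qed.

Lemma gap_meet_closed (S T : gap_set) : gap_closedb (val S `&` val T).
Proof.
by apply/asboolP => k [Sk Tk] [Sk2 Tk2]; split; apply: gap_setP.
Qed.

Lemma gap_join_closed (S T : gap_set) :
  gap_closedb (smallest gap_closed (val S `|` val T)).
Proof.
apply/asboolP => k Sk Sk2 U cU.
by apply: cU.1; [exact: Sk|exact: Sk2].
Qed.

Definition gap_meet (S T : gap_set) : gap_set := Sub _ (gap_meet_closed S T).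
Definition gap_join (S T : gap_set) : gap_set := Sub _ (gap_join_closed S T).

Lemma gap_meetP (S T U : gap_set) : (S <= gap_meet T U) = (S <= T) && (S <= U).
Proof.
apply/idP/andP => [/gap_leP|[/gap_leP ST /gap_leP SU]]; last apply/gap_leP.
  by rewrite SubK subsetI => -[ST SU]; split; apply/gap_leP.
by rewrite SubK subsetI.
Qed.

Lemma gap_joinP (S T U : gap_set) : (gap_join S T <= U) = (S <= U) && (T <= U).
Proof.
apply/idP/andP => [/gap_leP|[/gap_leP SU /gap_leP TU]]; last apply/gap_leP; rewrite SubK.
  move=> STU; split; apply/gap_leP => k Sk; apply: STU => V [_]; apply.
    by left.
  by right.
apply: smallest_sub; first exact: gap_setP.
by rewrite subUset.
Qed.

HB.instance Definition _ :=
  Order.POrder_MeetJoin_isLattice.Build gap_display gap_set gap_meetP gap_joinP.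

(* The bounds [3 n + i] make these sets closed: [3 n + i + 2] is not
   congruent to [i]. *)
Definition stage (n : nat) (a : M3) : set nat :=
  match a with
  | M3_bot => setT
  | M3_atom i => [set k | (k <= 3 * n + i)%N \/ (k %% 3)%N = i]
  | M3_top => [set k | (k <= 3 * n + 2)%N]
  end.

Lemma stage_closed n a : gap_closed (stage n a).
Proof. case: a => [|[i i3]|] k //=; lia. Qed.

Lemma stage0_closedb i : gap_closedb (stage 0 (M3_atom i)).
Proof. by apply/asboolP; exact: stage_closed. Qed.

(** Stage 0 adds 0, ..., i to the class of i, so that all three sets contain 0, the base case of
    [mem_balance]. *)
Definition residue (i : 'I_3) : gap_set := Sub _ (stage0_closedb i).

Lemma stageS n m a : (n <= m)%N -> stage n a `<=` stage m a.
Proof. case: a => [|[i i3]|] nm k //=; lia. Qed.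

(** The index must grow: 3 n + 2 lies in stage n of the top but not in stage n of atom 0. *)
Lemma stage_le n a a' : a' <= a -> stage n a `<=` stage n.+1 a'.
Proof.
case: a a' => [|[i i3]|] [|[j j3]|] //=; move=> // + k /=; last 2 first.
- by lia.
- by lia.
by move=> /eqP[<-]; lia.
Qed.

(** Residue classes are disjoint, so the stages of two distinct atoms share only numbers up to 3 n +
    2. *)
Lemma stageU n a a' : stage n a `&` stage n a' `<=` stage n (a `|` a').
Proof.
rewrite /Order.join /=.
case: a a' => [|[i i3]|] [|[j j3]|] k /= [] //=.
case: eqVneq => [[ij] /=|/eqP ij /=]; first by subst; lia.
have {}ij : i <> j by move=> ij'; apply: ij; exact: val_inj.
lia.
Qed.

(** * A non-compact intersection in M3 (x) F *)

Section M3Tensor.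
Context {d : Order.disp_t} (F : bLatticeType d) (g : 'I_3 -> F) (f : F -> gap_set).
Hypotheses (fI : Order.meet_morphism f) (fU : Order.join_morphism f).
Hypothesis fg : forall i, f (g i) = residue i.

Definition M3_diag : set (M3 * F) :=
  bi_join [set` [seq pure_tensor p.1 p.2 | p <- [seq (M3_atom i, g i) | i : 'I_3]]].

Lemma bi_ideal_M3_diag : bi_ideal M3_diag.
Proof. exact: bi_ideal_smallest. Qed.

Lemma M3_diag_gen i : M3_diag (M3_atom i, g i).
Proof.
move=> J [_]; apply; exists (pure_tensor (M3_atom i) (g i)); last by right.
apply/mapP; exists (M3_atom i, g i) => //.
by apply/mapP; exists i => //; rewrite mem_enum.
Qed.

Let f_homo a b : a <= b -> val (f a) `<=` val (f b).
Proof. by rewrite leEmeet => /eqP ab; apply/gap_leP/meet_idPl; rewrite -fI ab. Qed.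

Let f_join a b (U : set nat) : gap_closed U ->
  val (f a) `<=` U -> val (f b) `<=` U -> val (f (a `|` b)) `<=` U.
Proof.
move=> cU aU bU; rewrite fU; apply: smallest_sub => //.
by rewrite subUset.
Qed.

(** The pairs with such a bound form a bi-ideal containing the generators: [stage_le] gives
    down-closure, [stage_closed] the joins in F, [stageU] those in M3. *)
Lemma M3_diag_stage a b : M3_diag (a, b) -> exists n, val (f b) `<=` stage n a.
Proof.
pose H := [set p : M3 * F | exists n, val (f p.2) `<=` stage n p.1].
suff bH : bi_ideal H.
  suff : M3_diag `<=` H by apply.
  apply: smallest_sub => // q [_ /mapP[_ /mapP[i _ ->] ->]].
  by apply: (pure_tensorS bH); exists 0%N; rewrite /= fg SubK.
split=> [a1 b1 a2 b2 aa bb /= [n fn] | [a1 b1] [/= ->|/= ->] |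
         a1 b1 b2 /= [n fn] [m fm] | a1 a2 b1 /= [n fn] [m fm]].
- by exists n.+1; exact: subset_trans (f_homo bb) (subset_trans fn (stage_le aa)).
- by exists 0%N.
(* The bottom of F is below every generator, and the sets [residue i] have only 0 in common, which
   lies in every stage. *)
- have f0 i : val (f \bot) `<=` stage 0 (M3_atom i).
    by have := f_homo (le0x (g i)); rewrite fg.
  exists 0%N => k /[dup] /(f0 ord0) k0 /(f0 ord_max) k2.
  have -> : k = 0%N by move: k0 k2 => /=; lia.
  by case: a1 => //= i; left.
- exists (maxn n m); apply: f_join; first exact: stage_closed.
    by apply: subset_trans fn (stageS _); exact: leq_maxl.
  by apply: subset_trans fm (stageS _); exact: leq_maxr.
- exists (maxn n m); apply: subset_trans (@stageU _ _ _).
  rewrite subsetI; split.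
    by apply: subset_trans fn (stageS _); exact: leq_maxl.
  by apply: subset_trans fm (stageS _); exact: leq_maxr.
Qed.

Fixpoint balance (n : nat) (i : 'I_3) : F :=
  if n is m.+1 then
    balance m i `|` (balance m (ordS i) `&` balance m (ordS (ordS i)))
  else g i.

Lemma le_balance n i : g i <= balance n i.
Proof. by elim: n => //= n IH; exact: le_trans IH (leUl _ _). Qed.

Lemma balance_le n i (u : F) : (forall j, g j <= u) -> balance n i <= u.
Proof.
move=> gu; elim: n i => //= n IH i; rewrite leUx IH /=.
exact: le_trans (leIl _ _) (IH _).
Qed.

(** The other two atoms join to the top, so the meet of their iterates is paired with the top, hence
    by down-closure with atom i. *)
Lemma M3_diag_balance n i : M3_diag (M3_atom i, balance n i).
Proof.
have [Id _ IU UI] := bi_ideal_M3_diag.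
elim: n i => [i|n IH i] /=; first exact: M3_diag_gen.
apply: IU; first exact: IH.
pose j := ordS i; pose k := ordS j.
have jk : M3_atom j `|` M3_atom k = M3_top.
  rewrite /Order.join /=; case: eqP => // /(congr1 val) /=.
  by case: (i) => -[|[|[]]].
apply: (Id M3_top (balance n j `&` balance n k)) => //; rewrite -jk.
apply: UI.
  by apply: Id (IH j); [exact: lexx|exact: leIl].
by apply: Id (IH k); [exact: lexx|exact: leIr].
Qed.

Lemma mem_balance n i : val (f (balance n i)) n.
Proof.
elim: n i => [i|n IH i] /=; first by rewrite fg; left.
have resb (j : 'I_3) k : (k %% 3)%N = j -> val (f (balance n j)) k.
  by move=> kj; apply: (f_homo (le_balance n j)); rewrite fg; right.
(* Cases on n + 1 - i modulo 3. At 1, n + 1 is in the class of i + 1 and fills the gap between n and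
   n + 2 in the iterate at i + 2, so it is in the meet. At 0 it is in the class of i; at 2 it fills
   a gap in the iterate at i. *)
have [ni|ni] : (n.+1 %% 3)%N = ordS i \/ (n.+1 %% 3 = i \/ n.+2 %% 3 = i)%N.
- by rewrite /=; have := ltn_ord i; lia.
- apply: (f_homo (leUr _ _)); rewrite fI; split; first exact: resb.
  apply: gap_setP; first exact: IH.
  by apply: resb; move: ni => /=; have := ltn_ord i; lia.
- apply: (f_homo (leUl _ _)); have [ni1|ni2] := ni; first exact: resb.
  by apply: gap_setP; [exact: IH|exact: resb].
Qed.

Lemma M3_tensorI_neg :
  ~ (forall I J, tensor M3 F I -> tensor M3 F J -> tensor M3 F (I `&` J)).
Proof.
(* [u] serves as the 1 of F: it bounds every [balance n i]. *)
pose a := M3_atom ord0; pose u := g ord0 `|` g (ordS ord0) `|` g (ordS (ordS ord0)).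
have gu i : g i <= u.
  have [->|[->|->]] : i = ord0 \/ i = ordS ord0 \/ i = ordS (ordS ord0).
    by case: i => -[|[|[|//]]] i3; [left|right; left|right; right]; exact: val_inj.
  - by rewrite /u -joinA leUl.
  - by rewrite /u joinAC leUr.
  - by rewrite /u leUr.
move=> /(_ M3_diag (pure_tensor a u)) [||_].
- by apply/tensorE; eexists.
- exact: tensor_pure_tensor.
(* These pure tensors cover the intersection, so compactness would leave finitely many of them. *)
pose S := [set J : set (M3 * F) |
  exists2 b, M3_diag (a, b) & J = pure_tensor a b].
have [_ Sbot _ _] : bi_ideal (bi_join S) by exact: bi_ideal_smallest.
move=> /(_ S) [_ [b _ ->]|[x b] [+]|s sS sub].
- exact: bi_ideal_pure_tensor.
- move=> Dxb [xb0|/= [xa _]]; first exact: Sbot.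
  case: x Dxb xa => [_ _|i Dib /eqP i0|//]; first by apply: Sbot; left.
  rewrite i0 in Dib *; move=> J [_]; apply; exists (pure_tensor a b); last by right.
  by exists b.
(* The family is directed: joining second components stays in [M3_diag]. *)
have [b Db sb] : exists2 b, M3_diag (a, b) &
    forall J, J \in s -> J `<=` pure_tensor a b.
  have [Dd _ DU _] := bi_ideal_M3_diag.
  elim: s sS {sub} => [_|J s IH JsS]; first by exists (g ord0) => //; exact: M3_diag_gen.
  have [|b Db sb] := IH; first by move=> K Ks; apply: JsS; rewrite /= inE Ks orbT.
  have [c Dc ->] : S J by apply: JsS; rewrite /= inE eqxx.
  have mono x y : x <= y -> pure_tensor a x `<=` pure_tensor a y.
    move=> xy; apply: pure_tensorS; first exact: bi_ideal_pure_tensor.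
    by right.
  exists (c `|` b) => [|K]; first exact: DU.
  rewrite inE => /orP[/eqP ->|/sb Kb]; first exact/mono/leUl.
  exact/(subset_trans Kb)/mono/leUr.
have [n fb] := M3_diag_stage Db.
(* 3 n + 1 is the least number outside [stage n a], while [mem_balance] puts it in this iterate. *)
have le_b : balance (3 * n).+1 ord0 <= b.
  have /sub : (M3_diag `&` pure_tensor a u) (a, balance (3 * n).+1 ord0).
    by split; [exact: M3_diag_balance|right; split; [|exact: balance_le]].
  have sub_ab : bi_join [set` s] `<=` pure_tensor a b.
    apply: smallest_sub; first exact: bi_ideal_pure_tensor.
    by move=> p [J /sb]; apply.
  by move=> /sub_ab [[//|/= ->]|[]//]; exact: le0x.
by have /= := fb _ (f_homo le_b (mem_balance _ _)); lia.
Qed.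

End M3Tensor.

Theorem corollary8p2 (d : Order.disp_t) (F : bLatticeType d) (g : 'I_3 -> F)
    (F_free : free_lattice g) :
  ~ is_lattice (tensor M3 F) /\ ~ is_lattice (tensor F F).
Proof.
have [f [[fI fU fg] _]] := F_free _ _ residue.
have M3F := M3_tensorI_neg fI fU fg.
split=> [lat|lat]; apply: M3F; first by move=> I J; exact: is_lattice_tensorI.
have [h [[hI hU hg] _]] := F_free _ _ M3_atom.
apply: (tensorI_image hI hU); last by move=> I J; exact: is_lattice_tensorI.
case=> [|i|].
- by exists (g ord0 `&` g ord_max); rewrite hI !hg.
- by exists (g i).
- by exists (g ord0 `|` g ord_max); rewrite hU !hg.
Qed.
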